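(* Let $k$ be a field of characteristic $p>0$ and let $\omega\in k$ be a scalar that is not a $p$-th power in $k$. Let $L=k[t]/(t^p-\omega)$ and let $\mathfrak{g}=\mathrm{Der}_k(L)$, viewed as a restricted Lie algebra over $k$. Suppose that $k^\times=k^{\times(p-1)}$ (every element of $k^\times$ is a $(p-1)$-th power) and that the Brauer group $\mathrm{Br}(k)$ contains no element of order two. Then each restricted subalgebra $\mathfrak{g}'\subset\mathfrak{g}$ of dimension $1\leq \dim_k(\mathfrak{g}')\leq p-1$ is isomorphic, as a restricted Lie algebra, to either $k$ or $\mathfrak{gl}_1(k)$ or $k\rtimes\mathfrak{gl}_1(k)$ or $\mathfrak{sl}_2(k)$.
   Context: A restricted Lie algebra is a Lie algebra over a field of characteristic $p$ with a $p$-map $x\mapsto x^{[p]}$ satisfying Jacobson's axioms; restricted subalgebras are vector subspaces stable under bracket and $p$-map. $\mathrm{Der}_k(L)$ carries the commutator bracket and the $p$-map $D^{[p]}=D^p$ ($p$-fold composition). Here $k$ denotes the one-dimensional restricted Lie algebra with zero bracket and zero $p$-map; $\mathfrak{gl}_1(k)$ is one-dimensional with basis $e$, $e^{[p]}=e$; $\mathfrak{sl}_2(k)$ is the traceless $2\times2$-matrices with commutator and $p$-th power; and $k\rtimes\mathfrak{gl}_1(k)$ has underlying space $k\oplus ke$ with $[v+\lambda e,v'+\lambda'e]=\lambda v'-\lambda'v$ and $(v+\lambda e)^{[p]}=\lambda^{p-1}(v+\lambda e)$. *)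

(* Defs.v *)
From HB Require Import structures.
From mathcomp Require Import all_boot all_order all_algebra all_field.
From mathcomp Require Import qpoly ring.

Set Implicit Arguments.
Unset Strict Implicit.
Unset Printing Implicit Defensive.

Import GRing.Theory FalgLfun.
Local Open Scope ring_scope.

(* If T raises either index of m by one (a Leibniz rule), its iterates follow *)
(* the binomial pattern.                                                      *)
Lemma iter_leibniz (V : zmodType) (T : {additive V -> V})
    (m : nat -> nat -> V) (n : nat) :
    (forall i j, T (m i j) = m i.+1 j + m i j.+1) ->
  iter n T (m 0%N 0%N) = \sum_(i < n.+1) m i (n - i)%N *+ 'C(n, i).
Proof.
move=> Tm; elim: n => [|n IHn].
  by rewrite big_ord_recl big_ord0 /= bin0 addr0.
rewrite iterS IHn raddf_sum /=.
under eq_bigr => i _ do rewrite raddfMn Tm mulrnDl.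
rewrite big_split /= [RHS]big_ord_recl /= bin0 subn0 mulr1n.
under [X in _ = _ + X]eq_bigr => i _ do
  rewrite /bump /= add1n binS mulrnDr subSS.
rewrite big_split /= [X in _ = _ + (X + _)]big_ord_recr /=.
rewrite bin_small // mulr0n addr0.
rewrite [X in _ + X = _]big_ord_recl /= bin0 subn0 mulr1n.
rewrite addrCA [X in _ = _ + X]addrC; congr (_ + (_ + _)).
by apply: eq_bigr => i _; rewrite /bump /= add1n subnSK.
Qed.

Lemma pchar_binS (p i : nat) : prime p -> (0 < i < p)%N -> (p %| 'C(p, i))%N.
Proof. by move=> pp ip; apply: prime_dvd_bin. Qed.

Lemma pchar_sum_bin (R : nzRingType) (p : nat) (V : lmodType R)
    (F : nat -> V) : p \in [pchar R] ->
  \sum_(i < p.+1) F i *+ 'C(p, i) = F 0%N + F p.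
Proof.
move=> hp; have pp := pcharf_prime hp.
case: p hp pp => [|p] hp pp; first by [].
rewrite big_ord_recl big_ord_recr /= bin0 binn !mulr1n.
rewrite big1 ?add0r // => i _.
have /dvdnP[d ->] : (p.+1 %| 'C(p.+1, bump 0 i))%N.
  by apply: pchar_binS => //; rewrite /bump /= add1n ltnS /=.
by rewrite mulnC mulrnA -(scaler_nat p.+1) (pcharf0 hp) scale0r mul0rn.
Qed.

(* The coefficient of T^i in ad(T x + y)^n (x). *)
Fixpoint ad_coef (V : zmodType) (br : V -> V -> V) (x y : V) (n i : nat) : V :=
  if n is n'.+1 then
    (if i is i'.+1 then br x (ad_coef br x y n' i') else 0)
      + br y (ad_coef br x y n' i)
  else if i is 0%N then x else 0.

(* Jacobson's axioms.  The i-th summand in [pmapD] is s_i(x, y), determined   *)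
(* by: i s_i(x, y) is the coefficient of T^(i-1) in ad(T x + y)^(p-1) (x).    *)
Record restricted_lie_axioms (k : fieldType) (p : nat) (V : lmodType k)
    (br : V -> V -> V) (pm : V -> V) : Prop := RestrictedLieAxioms {
  rl_pchar : p \in [pchar k];
  brDl : forall a x y z, br (a *: x + y) z = a *: br x z + br y z;
  brDr : forall a x y z, br z (a *: x + y) = a *: br z x + br z y;
  brxx : forall x, br x x = 0;
  br_jacobi : forall x y z, br x (br y z) + br y (br z x) + br z (br x y) = 0;
  ad_pmap : forall x y, br (pm x) y = iter p (br x) y;
  pmapZ : forall a x, pm (a *: x) = a ^+ p *: pm x;
  pmapD : forall x y, pm (x + y) =
    pm x + pm y + \sum_(1 <= i < p) (i%:R : k)^-1 *: ad_coef br x y p.-1 i.-1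
}.

(* Only finite-dimensional restricted Lie algebras are considered. *)
Record restrictedLieType (k : fieldType) (p : nat) := RestrictedLieType {
  rl_sort :> vectType k;
  bracket : rl_sort -> rl_sort -> rl_sort;
  pmap : rl_sort -> rl_sort;
  rl_axioms : restricted_lie_axioms p bracket pmap
}.

Arguments RestrictedLieType {k p rl_sort bracket pmap}.

Definition rl_isomorphic (k : fieldType) (p : nat)
    (G H : restrictedLieType k p) : Prop :=
  exists f : {linear G -> H},
    [/\ bijective f,
        forall x y, f (bracket x y) = bracket (f x) (f y) &
        forall x, f (pmap x) = pmap (f x)].

Lemma ad_coef_morph (V W : zmodType) (brV : V -> V -> V) (brW : W -> W -> W)
    (f : {additive V -> W}) : (forall x y, f (brV x y) = brW (f x) (f y)) ->
  forall x y n i, f (ad_coef brV x y n i) = ad_coef brW (f x) (f y) n i.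
Proof.
move=> fb x y; elim=> [|n IHn] [|i] //=; rewrite ?raddf0 //.
  by rewrite raddfD raddf0 fb IHn.
by rewrite raddfD !fb !IHn.
Qed.

Section Transport.
Variables (k : fieldType) (p : nat) (V W : lmodType k).
Variables (brV : V -> V -> V) (pmV : V -> V).
Variables (brW : W -> W -> W) (pmW : W -> W) (f : {linear V -> W}).
Hypothesis f_inj : injective f.
Hypothesis f_br : forall x y, f (brV x y) = brW (f x) (f y).
Hypothesis f_pm : forall x, f (pmV x) = pmW (f x).

Lemma restricted_lie_transport :
  restricted_lie_axioms p brW pmW -> restricted_lie_axioms p brV pmV.
Proof.
case=> cp Dl Dr xx jac ad Z D; split=> //.
- by move=> a x y z; apply: f_inj; rewrite linearP !f_br linearP Dl.
- by move=> a x y z; apply: f_inj; rewrite linearP !f_br linearP Dr.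
- by move=> x; apply: f_inj; rewrite f_br xx linear0.
- by move=> x y z; apply: f_inj; rewrite !linearD !f_br linear0 jac.
- move=> x y; apply: f_inj; rewrite f_br f_pm ad.
  by elim: p => //= n ->; rewrite f_br.
- by move=> a x; apply: f_inj; rewrite f_pm !linearZ /= Z f_pm.
- move=> x y; apply: f_inj; rewrite f_pm !linearD /= D !f_pm linear_sum.
  congr (_ + _); apply: eq_bigr => i _.
  by rewrite linearZ /= (ad_coef_morph f_br).
Qed.

End Transport.

Section Commutator.
Variable R : nzRingType.

Definition comm_br (a b : R) : R := a * b - b * a.

Fact comm_br_is_additive a : zmod_morphism (comm_br a).
Proof.
by move=> x y; rewrite /comm_br mulrBr mulrBl opprD addrACA -opprD.
Qed.

End Commutator.

HB.instance Definition _ (R : nzRingType) (a : R) :=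
  GRing.isZmodMorphism.Build R R (comm_br a) (comm_br_is_additive a).

Section CommutatorIterates.
Variables (R : nzRingType) (p : nat).
Hypothesis hp : p \in [pchar R].

Lemma pchar_signb j : (j < p)%N -> (-1) ^+ j *+ 'C(p.-1, j) = 1 :> R.
Proof.
have pp := pcharf_prime hp; have p1 := prime_gt0 pp.
elim: j => [|j IHj] jp; first by rewrite bin0.
rewrite -[RHS](IHj (ltnW jp)).
have : 'C(p, j.+1)%:R = 0 :> R.
  apply/eqP; rewrite -(dvdn_pcharf hp); apply: pchar_binS => //.
rewrite -{1}(prednK p1) binS natrD => /eqP; rewrite addr_eq0 => /eqP e.
rewrite -[LHS]mulr_natr -[RHS]mulr_natr e exprS.
by rewrite mulN1r mulrN mulNr opprK.
Qed.

Lemma iter_comm_br (a c : R) n : iter n (comm_br a) c =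
  \sum_(i < n.+1) ((-1) ^+ (n - i) * (a ^+ i * c * a ^+ (n - i))) *+ 'C(n, i).
Proof.
have := @iter_leibniz R (comm_br a)
  (fun i j => (-1) ^+ j * (a ^+ i * c * a ^+ j)) n.
rewrite !expr0 !mul1r mulr1; apply=> i j.
rewrite [a ^+ i.+1]exprS [a ^+ j.+1]exprSr [(-1) ^+ j.+1]exprS.
by rewrite mulN1r mulNr /= /comm_br !mulrA (commr_sign a j).
Qed.

Lemma comm_br_pexp (a c : R) : comm_br (a ^+ p) c = iter p (comm_br a) c.
Proof.
rewrite iter_comm_br.
rewrite (pchar_sum_bin (V := R^o)
  (fun i => (-1) ^+ (p - i) * (a ^+ i * c * a ^+ (p - i))) hp).
rewrite subn0 subnn !expr0 !mul1r mulr1 addrC /comm_br; congr (_ + _).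
have := pFrobenius_autN hp 1; rewrite !pFrobenius_autE expr1n => ->.
by rewrite mulN1r.
Qed.

Lemma comm_br_pred (a c : R) : iter p.-1 (comm_br a) c =
  \sum_(i < p) a ^+ i * c * a ^+ (p.-1 - i).
Proof.
have p1 := prime_gt0 (pcharf_prime hp).
rewrite iter_comm_br (prednK p1); apply: eq_bigr => i _.
have ip : (i <= p.-1)%N by rewrite -ltnS prednK.
rewrite -mulrnAl -(bin_sub ip) pchar_signb ?mul1r //.
by rewrite (leq_ltn_trans (leq_subr _ _)) // prednK.
Qed.

End CommutatorIterates.

Section AssociativeJacobson.
Variables (R : nzRingType) (p : nat).
Hypothesis hp : p \in [pchar R].

Lemma deriv_exp_nc (q : {poly R}) n :
  (q ^+ n)^`() = \sum_(i < n) q ^+ i * q^`() * q ^+ (n.-1 - i).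
Proof.
elim: n => [|n IHn]; first by rewrite expr0 derivC big_ord0.
rewrite exprSr derivM IHn big_ord_recr /= subnn expr0 mulr1; congr (_ + _).
rewrite mulr_suml; apply: eq_bigr => i _; rewrite -!mulrA -exprSr.
by case: n i {IHn} => [[]|n] i //=; rewrite subSn // -ltnS.
Qed.

Lemma coef_ad (x y : R) n i :
  (iter n (comm_br (x%:P * 'X + y%:P)) x%:P)`_i = ad_coef (@comm_br R) x y n i.
Proof.
elim: n i => [|n IHn] i; first by rewrite /= coefC; case: i.
rewrite iterS; set z := iter n _ _ in IHn *; rewrite {1}/comm_br.
rewrite mulrDl mulrDr coefB !coefD -mulrA !coefCM coefMC mulrA coefMX.
rewrite coefMC opprD addrACA /= -!IHn; congr (_ + _).
by case: i => [|i]; rewrite coefXM /= ?mulr0 ?subr0 // -IHn.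
Qed.

Lemma coefn_expn (x y : R) n :
  (size ((x%:P * 'X + y%:P) ^+ n) <= n.+1)%N /\
  ((x%:P * 'X + y%:P) ^+ n)`_n = x ^+ n.
Proof.
elim: n => [|n [s IHn]]; first by rewrite !expr0 size_poly1 coef1.
rewrite exprS mulrDl; split; last first.
  by rewrite coefD -mulrA !coefCM coefXM /= IHn (nth_default _ s) mulr0 addr0
    exprS.
apply: leq_trans (size_polyD _ _) _; rewrite geq_max; apply/andP; split.
  rewrite -mulrA mul_polyC; apply: leq_trans (size_scale_leq _ _) _.
  apply: leq_trans (size_mul_leq _ _) _.
  by rewrite size_polyX.
rewrite mul_polyC; apply: leq_trans (size_scale_leq _ _) _.
exact: leq_trans s _.
Qed.

Lemma expr_jacobson (x y : R) : exists s : nat -> R,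
  (forall i, (0 < i < p)%N -> s i *+ i = ad_coef (@comm_br R) x y p.-1 i.-1) /\
  (x + y) ^+ p = x ^+ p + y ^+ p + \sum_(1 <= i < p) s i.
Proof.
have p1 := prime_gt0 (pcharf_prime hp).
pose q := x%:P * 'X + y%:P; exists (fun i => (q ^+ p)`_i); split=> [i|].
  case: i => // i _ /=; rewrite -coef_deriv deriv_exp_nc -coef_ad.
  have hP : p \in [pchar {poly R}] by rewrite pchar_poly.
  have -> : q^`() = x%:P by rewrite derivD derivM !derivC derivX mul0r add0r
    mulr1 addr0.
  by rewrite (comm_br_pred hP).
have q1 : (q ^+ p).[1] = (x + y) ^+ p.
  rewrite horner_exp_comm; last by rewrite /comm_poly mulr1 mul1r.
  by rewrite hornerD hornerMX !hornerC mulr1.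
have q0 : (q ^+ p)`_0 = y ^+ p.
  rewrite -horner_coef0 horner_exp_comm; last by rewrite /comm_poly mulr0 mul0r.
  by rewrite hornerD hornerMX !hornerC mulr0 add0r.
have [qs qp] := coefn_expn x y p.
rewrite -q1 (horner_coef_wide _ qs).
under eq_bigr => i _ do rewrite expr1n mulr1.
rewrite big_ord_recr /= qp -(big_mkord xpredT (fun i => (q ^+ p)`_i)).
by rewrite big_ltn // q0 addrC addrA.
Qed.

End AssociativeJacobson.

Lemma comm_br_axioms (k : fieldType) (p : nat) (A : algType k) :
  p \in [pchar k] ->
  restricted_lie_axioms p (@comm_br A) (fun a => a ^+ p).
Proof.
move=> hp; have hA : p \in [pchar A] by rewrite pchar_lalg.
split=> //.
- move=> a x y z; rewrite /comm_br mulrDl mulrDr -scalerAl -scalerAr.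
  by rewrite opprD addrACA scalerBr.
- move=> a x y z; rewrite /comm_br mulrDl mulrDr -scalerAl -scalerAr.
  by rewrite opprD addrACA scalerBr.
- by move=> x; rewrite /comm_br subrr.
- move=> x y z; rewrite /comm_br !mulrBl !mulrBr !mulrA !opprB.
  set a := x * y * z; set b := x * z * y; set c := y * z * x.
  set d := z * y * x; set e := y * x * z; set f := z * x * y.
  rewrite -[RHS](subrr (a + c + f + b + d + e)) !opprD !addrA.
  by rewrite [LHS](ACl (1*5*9*7*3*11*12*4*8*2*10*6)%AC).
- by move=> x y; rewrite (comm_br_pexp hA).
- by move=> a x; rewrite exprZn.
- move=> x y; have [s [Hs ->]] := expr_jacobson hA x y; congr (_ + _).
  apply: eq_big_nat => i ip; rewrite -(Hs _ ip) -scaler_nat scalerA mulVf ?scale1r //.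
  rewrite -(dvdn_pcharf hp); case/andP: ip => i0 ip.
  by rewrite gtnNdvd.
Qed.

Definition assoc_lie (k : fieldType) (p : nat) (hp : p \in [pchar k])
    (A : falgType k) : restrictedLieType k p :=
  RestrictedLieType (comm_br_axioms A hp).

Record restricted_subalgebra (k : fieldType) (p : nat)
    (G : restrictedLieType k p) (U : {vspace G}) : Prop :=
  RestrictedSubalgebra {
    subalg_bracket : forall x y, x \in U -> y \in U -> bracket x y \in U;
    subalg_pmap : forall x, x \in U -> pmap x \in U
  }.

Section Subalgebra.
Variables (k : fieldType) (p : nat) (G : restrictedLieType k p).
Variables (U : {vspace G}) (hU : restricted_subalgebra U).

Definition sub_bracket (x y : subvs_of U) : subvs_of U :=
  Subvs (subalg_bracket hU (subvsP x) (subvsP y)).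
Definition sub_pmap (x : subvs_of U) : subvs_of U :=
  Subvs (subalg_pmap hU (subvsP x)).

Lemma sub_lie_axioms : restricted_lie_axioms p sub_bracket sub_pmap.
Proof.
exact: (restricted_lie_transport (f := vsval) val_inj _ _ (rl_axioms G)).
Qed.

Definition sub_lie : restrictedLieType k p := RestrictedLieType sub_lie_axioms.

End Subalgebra.

Section Models.
Variables (k : fieldType) (p : nat) (hp : p \in [pchar k]).

Definition k_bracket (x y : k^o) : k^o := 0.
Definition k_pmap (x : k^o) : k^o := 0.

Lemma k_lie_axioms : restricted_lie_axioms p k_bracket k_pmap.
Proof.
have p1 := prime_gt1 (pcharf_prime hp).
have c0 n i x y : ad_coef k_bracket x y n.+1 i = 0.
  by case: i => [|i] /=; rewrite addr0.
split=> //; rewrite /k_bracket /k_pmap; try (by move=> *; rewrite ?scaler0 ?addr0).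
- by move=> x y; case: p p1.
- move=> x y; rewrite !add0r big1_seq // => i _.
  by case: p p1 => [|[|n]] // _; rewrite c0 scaler0.
Qed.

Definition k_lie : restrictedLieType k p := RestrictedLieType k_lie_axioms.

(* The basis vector e is 1 : k^o, and (a e)^[p] = a^p e. *)
Definition gl1_bracket (x y : k^o) : k^o := 0.
Definition gl1_pmap (x : k^o) : k^o := x ^+ p.

Lemma gl1_lie_axioms : restricted_lie_axioms p gl1_bracket gl1_pmap.
Proof.
apply: (restricted_lie_transport (f := idfun)
  (brW := @comm_br k^o) (pmW := fun a => a ^+ p)) => //.
- by move=> x y; rewrite /comm_br /= [y * x]mulrC subrr.
- exact: comm_br_axioms.
Qed.

Definition gl1_lie : restrictedLieType k p := RestrictedLieType gl1_lie_axioms.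

(* The pair (v, a) stands for v + a e. *)
Definition semi_bracket (x y : k^o * k^o) : k^o * k^o :=
  (x.2 * y.1 - y.2 * x.1, 0).
Definition semi_pmap (x : k^o * k^o) : k^o * k^o := x.2 ^+ p.-1 *: x.

Definition semi_mx (x : k^o * k^o) : 'M[k]_2 :=
  \matrix_(i, j) (if i == 0 then if j == 0 then x.2 else x.1 else 0).

Fact semi_mx_is_linear : linear semi_mx.
Proof.
move=> a x y; apply/matrixP => i j; rewrite !mxE.
by case: (i == 0) => //; [case: (j == 0)|rewrite mulr0 addr0].
Qed.

HB.instance Definition _ :=
  GRing.isLinear.Build k (k^o * k^o)%type 'M[k]_2 _ semi_mx semi_mx_is_linear.

Lemma semi_mxM x y : semi_mx x * semi_mx y = x.2 *: semi_mx y.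
Proof.
apply/matrixP => i j; rewrite !mxE !big_ord_recl big_ord0 !mxE /= mulr0 addr0.
by case: (i == 0); rewrite ?mulr0 ?mul0r ?addr0.
Qed.

Lemma semi_mxX x n : semi_mx x ^+ n.+1 = x.2 ^+ n *: semi_mx x.
Proof.
elim: n => [|n IHn]; first by rewrite expr0 scale1r.
by rewrite exprSr IHn -scalerAl semi_mxM scalerA -exprSr.
Qed.

Lemma semi_lie_axioms : restricted_lie_axioms p semi_bracket semi_pmap.
Proof.
apply: (restricted_lie_transport (f := semi_mx)
  (brW := @comm_br 'M[k]_2) (pmW := fun a => a ^+ p)).
- move=> [v a] [w b] /matrixP e; move: (e 0 0) (e 0 1); rewrite !mxE /=.
  by move=> -> ->.
- move=> x y; rewrite /comm_br !semi_mxM -!linearZ -linearB; congr semi_mx.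
  case: x y => v a [w b]; rewrite /semi_bracket /=.
  by congr pair; apply/esym/eqP; rewrite subr_eq0; apply/eqP; apply: mulrC.
- move=> x; rewrite linearZ /= -[in RHS](prednK (prime_gt0 (pcharf_prime hp))).
  by rewrite semi_mxX.
- exact: comm_br_axioms.
Qed.

Definition semi_lie : restrictedLieType k p := RestrictedLieType semi_lie_axioms.

Definition gl2_lie : restrictedLieType k p := assoc_lie hp 'M[k]_2.

Definition traceless : {vspace gl2_lie} :=
  lker (linfun (mxtrace : 'M[k]_2 -> k^o)).

Lemma memv_traceless (M : 'M[k]_2) : (M \in traceless) = (\tr M == 0).
Proof. by rewrite memv_ker lfunE. Qed.

Lemma traceless_subalgebra : restricted_subalgebra traceless.
Proof.
split=> [x y _ _|x].
  by rewrite memv_traceless /= /comm_br raddfB /= mxtrace_mulC subrr.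
rewrite !memv_traceless => /eqP tx; apply/eqP.
pose c := x 1 1 ^+ 2 + x 0 1 * x 1 0.
have x2 : x * x = c%:M.
  have I2 (i : 'I_2) : i = 0 \/ i = 1.
    by case: i => [[|[|//]] ?]; [left|right]; apply: val_inj.
  have {tx} : x 0 0 = - x 1 1.
    move: tx; rewrite /mxtrace !big_ord_recl big_ord0 addr0 => /eqP.
    by rewrite addr_eq0 => /eqP ->; congr (- x _ _); apply: val_inj.
  move=> tx.
  have l1 : lift ord0 (ord0 : 'I_1) = 1 :> 'I_2 by apply: val_inj.
  have l0 : ord0 = 0 :> 'I_2 by [].
  apply/matrixP => i j; rewrite !mxE !big_ord_recl big_ord0 l1 l0.
  by case: (I2 i) => ->; case: (I2 j) => ->; rewrite /= ?mulr1n ?mulr0n ?tx /c; ring.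
have pp := pcharf_prime hp.
case: (even_prime pp) => [p2|op]; rewrite /=.
  rewrite p2 expr2 x2 mxtrace_scalar -mulr_natr.
  by move: (pcharf0 hp); rewrite p2 => ->; rewrite mulr0.
rewrite -(odd_double_half p) op exprS -mul2n exprM expr2 x2.
have -> n : (c%:M : 'M_2) ^+ n = (c ^+ n)%:M.
  by elim: n => [|n IHn]; rewrite ?expr0 // !exprS IHn scalar_mxM.
by rewrite -mulmxE scalar_mxC mul_scalar_mx mxtraceZ tx mulr0.
Qed.

Definition sl2_lie : restrictedLieType k p := sub_lie traceless_subalgebra.

End Models.

Section Derivations.
Variables (k : fieldType) (p : nat) (hp : p \in [pchar k]) (A : falgType k).

Definition derivation (D : 'End(A)) : Prop :=
  forall x y, D (x * y) = D x * y + x * D y.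

Definition End_bracket (f g : 'End(A)) : 'End(A) := ((f \o g) - (g \o f))%VF.
Definition End_pmap (f : 'End(A)) : 'End(A) := iter p (comp_lfun f) \1%VF.

Lemma End_pmapE (f : 'End(A)) x : End_pmap f x = iter p f x.
Proof.
rewrite /End_pmap; elim: p => [|n IHn] /=; first by rewrite id_lfunE.
by rewrite comp_lfunE IHn.
Qed.

Lemma End_pmap_exp (f : 'End(A)) : End_pmap f = f ^+ p.
Proof.
rewrite /End_pmap; elim: p => [|n IHn] /=; first by rewrite expr0.
by rewrite exprSr -lfun_compE IHn.
Qed.

(* Multiplication in 'End(A) is composition in the opposite order, hence the  *)
(* embedding f |-> - f.                                                       *)
Lemma End_lie_axioms : restricted_lie_axioms p End_bracket End_pmap.
Proof.
apply: (restricted_lie_transport (f := -%R)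
  (brW := @comm_br 'End(A)) (pmW := fun a => a ^+ p)).
- exact: oppr_inj.
- move=> x y; rewrite /comm_br /End_bracket !mulrNN.
  exact: opprB.
- move=> x; have hE : p \in [pchar 'End(A)] by rewrite pchar_lalg.
  by have := pFrobenius_autN hE x; rewrite !pFrobenius_autE End_pmap_exp.
- exact: comm_br_axioms.
Qed.

Definition End_lie : restrictedLieType k p := RestrictedLieType End_lie_axioms.

Definition leibniz_defect (x y : A) (D : 'End(A)) : A :=
  D (x * y) - (D x * y + x * D y).

Fact leibniz_defect_is_linear x y : linear (leibniz_defect x y).
Proof.
move=> a f g; rewrite /leibniz_defect !add_lfunE !scale_lfunE mulrDl mulrDr.
rewrite -scalerAl -scalerAr addrACA -scalerDr opprD addrACA scalerBr.
by [].
Qed.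

HB.instance Definition _ x y :=
  GRing.isLinear.Build k 'End(A) A _ (leibniz_defect x y)
    (leibniz_defect_is_linear x y).

(* Leibniz' rule needs to be imposed on a basis only. *)
Definition Der_space : {vspace End_lie} :=
  (\bigcap_(i < \dim {:A}) \bigcap_(j < \dim {:A})
     lker (linfun (leibniz_defect (vbasis {:A})`_i (vbasis {:A})`_j)))%VS.

Lemma memv_Der (D : 'End(A)) : D \in Der_space <-> derivation D.
Proof.
split=> [|hD]; last first.
  rewrite memvE; apply/subv_bigcapP => i _; apply/subv_bigcapP => j _.
  by rewrite -memvE memv_ker lfunE /= /leibniz_defect hD subrr.
rewrite memvE => /subv_bigcapP hD.
have {}hD (i j : 'I_(\dim {:A})) :
    D ((vbasis {:A})`_i * (vbasis {:A})`_j) =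
      D (vbasis {:A})`_i * (vbasis {:A})`_j + (vbasis {:A})`_i * D (vbasis {:A})`_j.
  have /subv_bigcapP/(_ j isT) := hD i isT.
  by rewrite -memvE memv_ker lfunE /= subr_eq0 => /eqP.
have {}hD x (j : 'I_(\dim {:A})) :
    D (x * (vbasis {:A})`_j) =
      D x * (vbasis {:A})`_j + x * D (vbasis {:A})`_j.
  rewrite (coord_vbasis (memvf x)) linear_sum !mulr_suml linear_sum /=.
  rewrite -big_split; apply: eq_bigr => i _.
  by rewrite -scalerAl !linearZ /= hD -!scalerAl -scalerDr.
move=> x y; rewrite (coord_vbasis (memvf y)) linear_sum !mulr_sumr linear_sum /=.
rewrite -big_split; apply: eq_bigr => i _.
by rewrite -scalerAr !linearZ /= hD -!scalerAr -scalerDr.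
Qed.

Lemma iter_derivation (D : 'End(A)) x y n : derivation D ->
  iter n D (x * y) = \sum_(i < n.+1) (iter i D x * iter (n - i) D y) *+ 'C(n, i).
Proof.
move=> hD; apply: (iter_leibniz (m := fun i j => iter i D x * iter j D y)).
by move=> i j /=; rewrite hD.
Qed.

Lemma Der_subalgebra : restricted_subalgebra Der_space.
Proof.
split=> [f g /memv_Der hf /memv_Der hg|f /memv_Der hf]; apply/memv_Der => x y.
  rewrite !add_lfunE !opp_lfunE !comp_lfunE hf hg !linearD /= !hf !hg.
  rewrite mulrDl mulrDr mulNr mulrN !opprD !addrA.
  by rewrite [LHS](ACl (1*5*4*8*2*7*3*6)%AC) /= !addrK.
rewrite !End_pmapE (iter_derivation _ _ _ hf).
rewrite (pchar_sum_bin (V := A) (fun i => iter i f x * iter (p - i) f y) hp).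
by rewrite subn0 subnn addrC.
Qed.

Definition Der_lie : restrictedLieType k p := sub_lie Der_subalgebra.

End Derivations.

Section Tensor.
Variables (k : fieldType) (A B : falgType k).
Local Notation eA := (vbasis {:A}).
Local Notation eB := (vbasis {:B}).

(* A (x) B, in coordinates with respect to the e_i (x) f_j. *)
Definition tensor : Type := 'M[k]_(\dim {:A}, \dim {:B}).

HB.instance Definition _ := Vector.on tensor.

Definition pure (a : A) (b : B) : tensor :=
  \matrix_(i, j) (coord eA i a * coord eB j b).

Definition tensor_mul (M N : tensor) : tensor :=
  \sum_i \sum_j \sum_r \sum_s
    (M i j * N r s) *: pure (eA`_i * eA`_r) (eB`_j * eB`_s).

Lemma pureDl a a' b : pure (a + a') b = pure a b + pure a' b.
Proof. by apply/matrixP => i j; rewrite !mxE linearD mulrDl. Qed.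

Lemma pureDr a b b' : pure a (b + b') = pure a b + pure a b'.
Proof. by apply/matrixP => i j; rewrite !mxE linearD mulrDr. Qed.

Lemma pureZl c a b : pure (c *: a) b = c *: pure a b.
Proof. by apply/matrixP => i j; rewrite !mxE linearZ mulrA. Qed.

Lemma pureZr c a b : pure a (c *: b) = c *: pure a b.
Proof. by apply/matrixP => i j; rewrite !mxE linearZ mulrCA. Qed.

Lemma pure0l b : pure 0 b = 0.
Proof. by apply/matrixP => i j; rewrite !mxE linear0 mul0r. Qed.

Lemma pure0r a : pure a 0 = 0.
Proof. by apply/matrixP => i j; rewrite !mxE linear0 mulr0. Qed.

Lemma pure_suml (I : finType) (F : I -> A) b :
  pure (\sum_i F i) b = \sum_i pure (F i) b.
Proof.
exact: (big_morph (pure^~ b) (fun a a' => pureDl a a' b) (pure0l b)).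
Qed.

Lemma pure_sumr (I : finType) (F : I -> B) a :
  pure a (\sum_i F i) = \sum_i pure a (F i).
Proof.
exact: (big_morph (pure a) (pureDr a) (pure0r a)).
Qed.

Lemma tensor_basis (M : tensor) : M = \sum_i \sum_j M i j *: pure eA`_i eB`_j.
Proof.
rewrite {1}[M]matrix_sum_delta; apply: eq_bigr => i _; apply: eq_bigr => j _.
congr (_ *: _); apply/matrixP => r s; rewrite !mxE.
rewrite !coord_free ?(basis_free (vbasisP _)) // -natrM mulnb.
by rewrite [r == i]eq_sym [s == j]eq_sym.
Qed.

Lemma tensor_ind (P : tensor -> Prop) :
    (forall a b, P (pure a b)) -> (forall M N, P M -> P N -> P (M + N)) ->
  forall M, P M.
Proof.
move=> Pp PD M; have P0 : P 0 by rewrite -(pure0l 0).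
rewrite (tensor_basis M); apply: (big_ind P) => // i _.
by apply: (big_ind P) => // j _; rewrite -pureZl.
Qed.

Lemma tensor_mulDl M M' N :
  tensor_mul (M + M') N = tensor_mul M N + tensor_mul M' N.
Proof.
rewrite /tensor_mul -big_split; apply: eq_bigr => i _.
rewrite -big_split; apply: eq_bigr => j _.
rewrite -big_split; apply: eq_bigr => r _.
rewrite -big_split; apply: eq_bigr => s _.
by rewrite /= mxE mulrDl scalerDl.
Qed.

Lemma tensor_mulDr M N N' :
  tensor_mul M (N + N') = tensor_mul M N + tensor_mul M N'.
Proof.
rewrite /tensor_mul -big_split; apply: eq_bigr => i _.
rewrite -big_split; apply: eq_bigr => j _.
rewrite -big_split; apply: eq_bigr => r _.
rewrite -big_split; apply: eq_bigr => s _.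
by rewrite /= mxE mulrDr scalerDl.
Qed.

Lemma tensor_mulZl c M N : c *: tensor_mul M N = tensor_mul (c *: M) N.
Proof.
rewrite /tensor_mul scaler_sumr; apply: eq_bigr => i _.
rewrite scaler_sumr; apply: eq_bigr => j _.
rewrite scaler_sumr; apply: eq_bigr => r _.
rewrite scaler_sumr; apply: eq_bigr => s _.
by rewrite scalerA mxE mulrA.
Qed.

Lemma tensor_mulZr c M N : c *: tensor_mul M N = tensor_mul M (c *: N).
Proof.
rewrite /tensor_mul scaler_sumr; apply: eq_bigr => i _.
rewrite scaler_sumr; apply: eq_bigr => j _.
rewrite scaler_sumr; apply: eq_bigr => r _.
rewrite scaler_sumr; apply: eq_bigr => s _.
by rewrite scalerA mxE mulrCA.
Qed.

Lemma tensor_mul_pure a b c d :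
  tensor_mul (pure a b) (pure c d) = pure (a * c) (b * d).
Proof.
rewrite [in RHS](coord_vbasis (memvf a)) [in RHS](coord_vbasis (memvf b)).
rewrite [in RHS](coord_vbasis (memvf c)) [in RHS](coord_vbasis (memvf d)).
rewrite !mulr_suml pure_suml; apply: eq_bigr => i _.
rewrite pure_sumr; apply: eq_bigr => j _.
rewrite !mulr_sumr pure_suml; apply: eq_bigr => r _.
rewrite pure_sumr; apply: eq_bigr => s _.
rewrite -!scalerAl -!scalerAr !(pureZl, pureZr) !scalerA !mxE.
by congr (_ *: _); ring.
Qed.

Fact tensor_mulA : associative tensor_mul.
Proof.
move=> M N P; elim/tensor_ind: M => [a b|M M' hM hM']; last first.
  by rewrite !tensor_mulDl hM hM'.
elim/tensor_ind: N => [c d|N N' hN hN']; last first.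
  by rewrite !(tensor_mulDl, tensor_mulDr) hN hN'.
elim/tensor_ind: P => [e f|P P' hP hP']; last by rewrite !tensor_mulDr hP hP'.
by rewrite !tensor_mul_pure !mulrA.
Qed.

Fact tensor_mul1l : left_id (pure 1 1) tensor_mul.
Proof.
elim/tensor_ind => [a b|M M' hM hM']; first by rewrite tensor_mul_pure !mul1r.
by rewrite tensor_mulDr hM hM'.
Qed.

Fact tensor_mul1r : right_id (pure 1 1) tensor_mul.
Proof.
elim/tensor_ind => [a b|M M' hM hM']; first by rewrite tensor_mul_pure !mulr1.
by rewrite tensor_mulDl hM hM'.
Qed.

Fact tensor_1neq0 : pure 1 1 != 0.
Proof.
have nz (C : falgType k) : exists i, coord (vbasis {:C}) i 1 != 0.
  apply/existsP; apply: contraT; rewrite negb_exists => /forallP h.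
  have := oner_neq0 C; rewrite (coord_vbasis (memvf 1)) big1 ?eqxx // => i _.
  by move: (h i); rewrite negbK => /eqP ->; rewrite scale0r.
have [i hi] := nz A; have [j hj] := nz B.
by apply/eqP => /matrixP/(_ i j)/eqP; rewrite !mxE mulf_eq0 (negPf hi) (negPf hj).
Qed.

HB.instance Definition _ := GRing.Zmodule_isNzRing.Build tensor
  tensor_mulA tensor_mul1l tensor_mul1r tensor_mulDl tensor_mulDr tensor_1neq0.
HB.instance Definition _ := GRing.Lmodule_isLalgebra.Build k tensor tensor_mulZl.
HB.instance Definition _ := GRing.Lalgebra_isAlgebra.Build k tensor tensor_mulZr.
HB.instance Definition _ := Algebra_isFalgebra.Build k tensor.

End Tensor.

Section Brauer.
Variable k : fieldType.

Definition alg_isomorphic (A B : falgType k) : Prop :=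
  exists f : {lrmorphism A -> B}, bijective f.

Definition central (A : falgType k) : Prop :=
  forall z : A, (forall x, z * x = x * z) -> exists c : k, z = c%:A.

Definition two_sided_ideal (A : falgType k) (I : {vspace A}) : Prop :=
  forall a x, x \in I -> a * x \in I /\ x * a \in I.

Definition simple_alg (A : falgType k) : Prop :=
  forall I : {vspace A}, two_sided_ideal I -> I = 0%VS \/ I = fullv.

Definition central_simple (A : falgType k) : Prop := central A /\ simple_alg A.

Definition brauer_equivalent (A B : falgType k) : Prop :=
  exists m n : nat,
    alg_isomorphic (tensor A 'M[k]_m.+1) (tensor B 'M[k]_n.+1).

(* The elements of Br(k) are the classes [A] of central simple algebras, with *)
(* [A] + [B] = [A (x) B] and neutral element [k].                             *)
Definition brauer_order_two (A : falgType k) : Prop :=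
  [/\ central_simple A, ~ brauer_equivalent A k^o
    & brauer_equivalent (tensor A A) k^o].

End Brauer.

HB.instance Definition _ (k : fieldType) (h : {poly k}) :=
  Vector.on {poly %/ h}.

(* {poly %/ h} is the quotient by [mk_monic h], so by the expected polynomial *)
(* when h = 'X^p - omega%:P.                                                  *)
Lemma mk_monic_XpsubC (k : fieldType) (p : nat) (omega : k) : (0 < p)%N ->
  mk_monic ('X^p - omega%:P) = 'X^p - omega%:P.
Proof.
move=> p0; rewrite /mk_monic size_XnsubC // ltnS p0.
by rewrite monicXnsubC.
Qed.

(* Main.v *)
(* L is a field of prime degree p over k, so a nonzero derivation D has kernel
   k; hence every derivation is a D for some a in L, the centralizer of D is
   k D, and D^p lies in k D.  A subalgebra of dimension at least 2 contains an X
   with X^p != 0, which is rescaled so that X^p = X; since ad X is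
   diagonalizable with eigenvalues in F_p, a further rescaling gives E and a
   unit u with E u = u and both E and u E in the subalgebra.  The subalgebra is
   then spanned by elements u^j E, and [u^i E, u^j E] = (j - i) u^(i+j) E only
   leaves the exponents {0, 1} and {-1, 0, 1}.  The latter is the split form of
   sl_2, so no quaternion algebra has to be considered. *)

From HB Require Import structures.
Require Import Defs.
From mathcomp Require Import all_boot all_order all_algebra all_field.
From mathcomp Require Import qpoly qfpoly ring.

Set Implicit Arguments.
Unset Strict Implicit.
Unset Printing Implicit Defensive.

Import GRing.Theory FalgLfun.
Local Open Scope ring_scope.

Local Notation pmap := Defs.pmap.

(** * Irreducibility of X^p - omega *)

(* If r is a factor of degree m, its companion matrix C satisfies
   C ^+ p = omega%:M, so omega ^+ m = (\det C) ^+ p; as m is prime to p, omega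
   is a p-th power. *)
Lemma irreducible_XnsubC (k : fieldType) (p : nat) (omega : k) :
  prime p -> (forall x : k, x ^+ p <> omega) ->
  irreducible_poly ('X^p - omega%:P).
Proof.
move=> pp nroot; have p0 := prime_gt0 pp.
have nz_omega : omega != 0.
  by apply/eqP=> w0; apply: (nroot 0); rewrite w0 expr0n -leqn0 leqNgt p0.
have hn0 : 'X^p - omega%:P != 0 by rewrite -size_poly_gt0 size_XnsubC.
split=> [|r r1 rh]; first by rewrite size_XnsubC.
have rn0 : r != 0 by apply: contraTneq rh => ->; rewrite dvd0p.
rewrite /eqp rh /=; have rle := dvdp_leq hn0 rh.
have [|rp] := ltnP (size r) p.+1; last first.
  have sz : size r = size ('X^p - omega%:P).
    by apply/eqP; rewrite eqn_leq rle size_XnsubC.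
  by have := dvdp_size_eqp rh; rewrite sz eqxx /eqp => /esym/andP[].
move=> rp; exfalso.
pose q := (lead_coef r)^-1 *: r.
have lr0 : (lead_coef r)^-1 != 0 by rewrite invr_eq0 lead_coef_eq0.
have qm : q \is monic by rewrite monicE lead_coefZ mulVf // lead_coef_eq0.
have qh : q %| 'X^p - omega%:P by rewrite dvdpZl.
have sq : size q = size r by rewrite size_scale.
(* The degree of q is n + 1, so its companion matrix has positive size and lives in a ring. *)
have [n sqn] : exists n, size q = n.+2.
  rewrite sq; case: (size r) (size_poly_gt0 r) r1 => [|[|n]] //;
    last by exists n.
  by rewrite rn0.
have chq := companionmxK qm; move: (companionmx q) chq.
rewrite sqn /= => C chq.
have Cq : horner_mx C q = 0 by rewrite -chq Cayley_Hamilton.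
have Cp : C ^+ p = omega%:M.
  move/dvdpP: qh => [g /(congr1 (horner_mx C))].
  rewrite rmorphM /= Cq mulr0 rmorphB rmorphXn /= horner_mx_X horner_mx_C.
  by move/eqP; rewrite subr_eq0 => /eqP.
have dC : (\det C) ^+ p = omega ^+ n.+1.
  rewrite -(det_scalar n.+1 omega) -Cp.
  by elim: (p) => [|i IHi]; rewrite ?det1 // !exprS det_mulmx IHi.
have cop : coprime p n.+1.
  by rewrite prime_coprime // gtnNdvd // -ltnS -sqn sq.
have [a _] := Bezoutl n.+1 p0.
rewrite (eqP cop) => /dvdnP[b eab].
have dn0 : \det C != 0.
  by apply: contra_neq nz_omega => d0; move/eqP: dC; rewrite d0 expr0n
    gtn_eqF // eq_sym expf_eq0 /= => /eqP.
(* Bezout gives b p = 1 + a (n + 1), so the p-th power of this quotient is omega^(b p - a (n + 1)) =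
   omega. *)
apply: (nroot (omega ^+ b / \det C ^+ a)).
rewrite expr_div_n -!exprM -eab [(a * p)%N]mulnC exprM dC -exprM mulnC.
by rewrite exprD expr1 mulfK // expf_neq0.
Qed.

(** * Isomorphisms obtained inside a common ambient algebra *)

(** The maps i and F have the same image in W, so F^-1 i and i^-1 F are mutually inverse;
    compatibility with the operations is checked after applying F. *)
Lemma rl_isomorphic_of_images (k : fieldType) (p : nat)
    (G H W : restrictedLieType k p) (i : {linear G -> W}) (F : {linear H -> W})
      :
    injective i -> injective F ->
    (forall x, exists y, i x = F y) -> (forall y, exists x, F y = i x) ->
    {morph i : x y / bracket x y} -> {morph F : x y / bracket x y} ->
    {morph i : x / pmap x} -> {morph F : x / pmap x} ->
  rl_isomorphic G H.
Proof.
move=> i_inj F_inj iF Fi ibr Fbr ipm Fpm.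
pose f : 'Hom(G, H) := ((linfun F)^-1 \o linfun i)%VF.
pose g : 'Hom(H, G) := ((linfun i)^-1 \o linfun F)%VF.
have Ff x : F (f x) = i x.
  rewrite comp_lfunE [linfun i x]lfunE /= -[LHS](lfunE F) limg_lfunVK //.
  by have [y ->] := iF x; rewrite -[F y](lfunE F) memv_img ?memvf.
have ig y : i (g y) = F y.
  rewrite comp_lfunE [linfun F y]lfunE /= -[LHS](lfunE i) limg_lfunVK //.
  by have [x ->] := Fi y; rewrite -[i x](lfunE i) memv_img ?memvf.
exists f; split=> [|x y|x].
- by exists g => x; [apply: i_inj; rewrite ig Ff | apply: F_inj; rewrite Ff ig].
- by apply: F_inj; rewrite Ff ibr Fbr !Ff.
- by apply: F_inj; rewrite Ff ipm Fpm Ff.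
Qed.

(* ad (pmap y) = (ad y)^p determines pmap y up to the center. *)
Lemma pmap_morph_centerless (k : fieldType) (p : nat)
    (G H W : restrictedLieType k p) (i : {linear G -> W}) (F : {linear H -> W})
      :
    injective F ->
    (forall x, exists y, i x = F y) -> (forall y, exists x, F y = i x) ->
    {morph F : x y / bracket x y} -> {morph i : x / pmap x} ->
    (forall z : H, (forall x, bracket z x = 0) -> z = 0) ->
  {morph F : x / pmap x}.
Proof.
move=> F_inj iF Fi Fbr ipm center_H y.
have [x yx] := Fi y; have [z pz] := iF (pmap x).
(* Both z and [pmap y] act on H as (ad y)^p, so their difference is central. *)
rewrite yx -ipm pz; congr (F _); apply/eqP; rewrite -subr_eq0; apply/eqP.
have Hax := rl_axioms H; have Wax := rl_axioms W.
apply: center_H => t; apply: F_inj.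
have := brDl Hax (-1) z (pmap y) t; rewrite !scaleN1r addrC => ->.
rewrite addrC linear0 linearB /= !Fbr -pz ipm -yx (ad_pmap Wax).
rewrite -Fbr (ad_pmap Hax).
have Fiter n : iter n (bracket (F y)) (F t) = F (iter n (bracket y) t).
  by elim: n => //= n ->; rewrite Fbr.
by rewrite Fiter subrr.
Qed.

(** * Coordinates on sl_2 *)

Section SpecialLinear.

Variables (k : fieldType) (p : nat) (hp : p \in [pchar k]).
Local Notation mx M := (vsval M : 'M[k]_2).

Lemma sl2_entry11 (M : sl2_lie hp) : mx M 1 1 = - mx M 0 0.
Proof.
have := subvsP M; rewrite memv_traceless /mxtrace !big_ord_recl big_ord0 addr0.
have -> : lift ord0 (ord0 : 'I_1) = 1 :> 'I_2 by apply: val_inj.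
by rewrite addrC addr_eq0 => /eqP.
Qed.

Lemma sl2_bracketE (M N : sl2_lie hp) :
  [/\ mx (bracket M N) 0 0 = mx M 0 1 * mx N 1 0 - mx N 0 1 * mx M 1 0,
      mx (bracket M N) 0 1 = 2 * (mx M 0 0 * mx N 0 1 - mx N 0 0 * mx M 0 1)
    & mx (bracket M N) 1 0 = 2 * (mx M 1 0 * mx N 0 0 - mx N 1 0 * mx M 0 0)].
Proof.
have l1 : lift ord0 (ord0 : 'I_1) = 1 :> 'I_2 by apply: val_inj.
have l0 : ord0 = 0 :> 'I_2 by [].
have h1 := sl2_entry11 M; have h2 := sl2_entry11 N.
rewrite /= /comm_br; split; rewrite !mxE !big_ord_recl !big_ord0 l1 l0;
  rewrite ?h1 ?h2; ring.
Qed.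

Lemma sl2_exists (a b c : k) : exists M : sl2_lie hp,
  [/\ mx M 0 0 = a, mx M 0 1 = b & mx M 1 0 = c].
Proof.
pose m : 'M[k]_2 := \matrix_(i, j)
  (if i == 0 then if j == 0 then a else b else if j == 0 then c else - a).
have mT : m \in traceless hp.
  by rewrite memv_traceless /mxtrace !big_ord_recl big_ord0 !mxE /= addr0 subrr.
by exists (Subvs mT); rewrite /= !mxE.
Qed.

Lemma sl2_ext (M N : sl2_lie hp) : mx M 0 0 = mx N 0 0 ->
  mx M 0 1 = mx N 0 1 -> mx M 1 0 = mx N 1 0 -> M = N.
Proof.
move=> e00 e01 e10; apply: val_inj; apply/matrixP => i j.
have I2 (l : 'I_2) : l = 0 \/ l = 1.
  by case: l => [[|[|//]] ?]; [left|right]; apply: val_inj.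
case: (I2 i) => ->; case: (I2 j) => -> //.
by have := sl2_entry11 M; have := sl2_entry11 N; rewrite /= e00 => -> ->.
Qed.

End SpecialLinear.

(** * Derivations of an extension of degree p *)

Section PrimeDegree.

Variables (k : fieldType) (p : nat) (hp : p \in [pchar k]).
Variable L : fieldExtType k.
Hypothesis dimL : \dim {:L} = p.
Implicit Types (D E X Y : 'End(L)) (a b u : L) (c : k).

Let p_prime : prime p := pcharf_prime hp.
Let br := @End_bracket k L.
Let pm := @End_pmap k p L.
Let ax := End_lie_axioms hp L.

Lemma brE D E x : br D E x = D (E x) - E (D x).
Proof. by rewrite /br /End_bracket add_lfunE opp_lfunE !comp_lfunE. Qed.

Lemma derivation_Derivation D : derivation D -> Derivation {:L} D.
Proof. by move=> hD; apply/allrelP => x y _ _; apply/eqP/hD. Qed.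

Lemma derivation_scalar D c : derivation D -> D c%:A = 0.
Proof.
move=> /derivation_Derivation hD; apply: (Derivation_scalar hD).
by rewrite rpredZ ?mem1v.
Qed.

Lemma derivation_exp D x m :
  derivation D -> D (x ^+ m) = x ^+ m.-1 *+ m * D x.
Proof. by move=> /derivation_Derivation hD;
  rewrite (Derivation_exp hD) ?memvf. Qed.

(* The degree being prime, an element outside k generates L. *)
Lemma derivation_ker D x :
  derivation D -> D != 0 -> D x = 0 -> exists c, x = c%:A.
Proof.
move=> hD nzD Dx; apply/vlineP; apply: contraNT nzD => x1; apply/eqP/lfunP=> y.
rewrite lfunE /=.
have Kfull : <<1; x>>%VS = fullv.
  apply/eqP; rewrite eqEdim subvf /= dimL.
  have := field_dimS (subvf <<1; x>>%AS); rewrite dimL.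
  case/primeP: (p_prime) => _ prm /prm/pred2P[e1|-> //].
  have [_] := dimv_leqif_eq (subv_adjoin 1 x).
  by rewrite e1 dimv1 eqxx => /esym/eqP e; rewrite e memv_adjoin in x1.
have /Fadjoin_polyP[q q1 ->] : y \in <<1; x>>%VS by rewrite Kfull memvf.
have q_full : q \is a polyOver (fullv : {vspace L}) by apply: polyOverS q1 => z
  _; apply: memvf.
rewrite (Derivation_horner (derivation_Derivation hD)) ?memvf // Dx mulr0 addr0.
(* The coefficients of q lie in k, where D vanishes. *)
rewrite (_ : map_poly D q = 0) ?horner0 //; apply/polyP=> i.
rewrite coef0 coef_map_id0 ?linear0 //.
by apply: (Derivation_scalar (derivation_Derivation hD)); apply/polyOverP.
Qed.

(** The L-module structure on derivations: for fixed nonzero D, it transports questions about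
    derivations to elements a of L. *)
Definition dmul D a : 'End(L) := (amull a \o D)%VF.

Lemma dmulE D a x : dmul D a x = a * D x.
Proof. by rewrite comp_lfunE lfunE. Qed.

Fact dmul_is_linear D : linear (dmul D).
Proof.
move=> c a b; apply/lfunP=> x.
by rewrite add_lfunE scale_lfunE !dmulE mulrDl scalerAl.
Qed.

HB.instance Definition _ D :=
  GRing.isLinear.Build k L 'End(L) _ (dmul D) (dmul_is_linear D).

Lemma dmul1 D : dmul D 1 = D.
Proof. by apply/lfunP=> x; rewrite dmulE mul1r. Qed.

Lemma dmul_alg D c : dmul D c%:A = c *: D.
Proof. by rewrite linearZ /= dmul1. Qed.

Lemma derivation_dmul D a : derivation D -> derivation (dmul D a).
Proof. by move=> hD x y; rewrite !dmulE hD; ring. Qed.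

Lemma br_dmul D a b : derivation D ->
  br (dmul D a) (dmul D b) = dmul D (a * D b - b * D a).
Proof. by move=> hD; apply/lfunP=> x; rewrite brE !dmulE !hD; ring. Qed.

Lemma lfun_neq0 D : D != 0 -> exists x, D x != 0.
Proof.
by case/lfunPn=> x Dx; exists x; rewrite lfunE in Dx.
Qed.

Lemma dmul_inj D : D != 0 -> injective (dmul D).
Proof.
case/lfun_neq0=> x Dx a b /lfunP/(_ x); rewrite !dmulE; exact: mulIf.
Qed.

(** Take x with D x != 0 and a = E x / D x. Then E - a D kills x; were it nonzero, its kernel would
    be k, forcing x into k and D x = 0. *)
Lemma derivation_dmul_of D E :
  derivation D -> D != 0 -> derivation E -> exists a, E = dmul D a.
Proof.
move=> hD nzD hE; have [x Dx] := lfun_neq0 nzD; exists (E x / D x).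
apply/eqP; rewrite -subr_eq0; apply/negPn/negP=> nzE.
have hE' : derivation (E - dmul D (E x / D x)).
  by move=> y z; rewrite !add_lfunE !opp_lfunE !dmulE hE hD; ring.
have [|c xc] := derivation_ker hE' nzE (x := x).
  by rewrite add_lfunE opp_lfunE dmulE divfK ?subrr.
by move: Dx; rewrite xc derivation_scalar ?eqxx.
Qed.

Lemma derivation_pmap D : derivation D -> derivation (pm D).
Proof. by move/memv_Der/(subalg_pmap (Der_subalgebra hp L))/memv_Der. Qed.

(** For E = a D the bracket is D(a) D, so a lies in the kernel k of D. *)
Lemma derivation_centralizer D E : derivation D -> D != 0 -> derivation E ->
  br D E = 0 -> exists c, E = c *: D.
Proof.
move=> hD nzD hE; have [a ->] := derivation_dmul_of hD nzD hE.
rewrite -{1}[D]dmul1 br_dmul // -[in D 1](scale1r 1) derivation_scalar //.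
rewrite mulr0 subr0 mul1r -[RHS](linear0 (dmul D)) => /(dmul_inj nzD) Da.
by have [c ->] := derivation_ker hD nzD Da; exists c; rewrite dmul_alg.
Qed.

(** D^p is a derivation commuting with D. *)
Lemma derivation_pmap_scalar D : derivation D -> exists c, pm D = c *: D.
Proof.
move=> hD; have [->|nzD] := eqVneq D 0.
  exists 0; have := pmapZ ax 0 0.
  by rewrite scale0r expr0n gtn_eqF ?prime_gt0 // !scale0r.
apply: derivation_centralizer => //; first exact: derivation_pmap.
apply/lfunP=> x; rewrite brE !End_pmapE lfunE /=.
by rewrite -iterSr -iterS subrr.
Qed.


(** * Elements with nonzero p-map and their normalization *)

Lemma brC D E : br D E = - br E D.
Proof. by rewrite /br /End_bracket opprB. Qed.

Lemma br0r D : br D 0 = 0.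
Proof. by apply/lfunP=> x; rewrite brE !lfunE linear0 subr0. Qed.

Lemma brZr D E c : br D (c *: E) = c *: br D E.
Proof. by apply/lfunP=> x; rewrite brE !scale_lfunE brE linearZ scalerBr. Qed.

Lemma iter_br_eigen D E c n : br D E = c *: E -> iter n (br D) E = c ^+ n *: E.
Proof.
move=> DE; elim: n => [|n IHn]; first by rewrite scale1r.
by rewrite iterS IHn brZr DE scalerA -exprSr.
Qed.

(* If pm D = 0 then ad D is nilpotent, so some X of U that is not a multiple of
   D has [D, X] = c *: D with c != 0; then ad X is not nilpotent on D. *)
Lemma pmap_neq0 (U : {vspace 'End(L)}) D Y :
    {in U, forall X, derivation X} -> {in U &, forall X Y, br X Y \in U} ->
    D \in U -> D != 0 -> Y \in U -> Y \notin <[D]>%VS ->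
  exists2 X, X \in U & pm X != 0.
Proof.
move=> derU brU DU nzD YU YD; have [pD|nz] := eqVneq (pm D) 0; last by exists D.
have br0l X : br 0 X = 0 by rewrite brC br0r oppr0.
have ex : exists n, iter n (br D) Y \in <[D]>%VS.
  by exists p; rewrite -(ad_pmap ax) -/br -/pm pD br0l mem0v.
case: (ex_minnP ex) => [[|n]] mem min; first by rewrite /= mem in YD.
(* X is the last iterate outside the line of D. *)
pose X := iter n (br D) Y.
have XU : X \in U by rewrite /X; elim: (n) => //= i IHi; apply: brU.
have XD : X \notin <[D]>%VS by apply/negP=> /min; rewrite ltnn.
have /vlineP[c brDX] : br D X \in <[D]>%VS by [].
have nzc : c != 0.
  apply: contraNneq XD => c0; apply/vlineP.
  by apply: derivation_centralizer; rewrite ?brDX ?c0 ?scale0r //; apply: derU.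
exists X => //; apply/eqP=> pX.
have := ad_pmap ax X D; rewrite -/br -/pm pX br0l.
(* D is an eigenvector of ad X for -c, so (ad X)^p D = (-c)^p D is nonzero. *)
rewrite (@iter_br_eigen _ _ (- c)); last by rewrite brC brDX scaleNr.
by move/esym/eqP; rewrite scaler_eq0 expf_eq0 oppr_eq0 (negPf nzc) (negPf nzD)
  andbF.
Qed.

Hypothesis hroots : forall c, c != 0 -> exists2 d, d != 0 & d ^+ p.-1 = c.

(** If X^p = c X, then (d X)^p = d^(p-1) c (d X); a (p-1)-th root d of 1/c does it. *)
Lemma pmap_normalize X : derivation X -> pm X != 0 ->
  exists2 c, c != 0 & pm (c *: X) = c *: X.
Proof.
move=> hX; have [c pX] := derivation_pmap_scalar hX.
rewrite pX scaler_eq0 negb_or => /andP[nzc nzX].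
have [|d nzd dc] := hroots (c := c^-1); first by rewrite invr_eq0.
exists d => //; rewrite [LHS](pmapZ ax) -/pm pX scalerA; congr (_ *: _).
by rewrite -(prednK (prime_gt0 p_prime)) exprS dc mulfVK.
Qed.


(** * Eigenvectors with eigenvalue in the prime field *)

Section HornerEigen.

Variable D : 'End(L).

Lemma horner_alg_eigen (q : {poly k}) x c :
  D x = c *: x -> horner_alg D q x = q.[c] *: x.
Proof.
move=> Dx; elim/poly_ind: q => [|q d IHq].
  by rewrite rmorph0 horner0 scale0r lfunE.
rewrite rmorphD rmorphM /= horner_algC horner_algX add_lfunE lfun_mulE.
by rewrite scale_lfunE id_lfunE IHq linearZ /= Dx scalerA hornerMXaddC scalerDl.
Qed.

Lemma horner_alg_stable (V : {vspace L}) (q : {poly k}) x :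
  {in V, forall y, D y \in V} -> x \in V -> horner_alg D q x \in V.
Proof.
move=> DV xV; elim/poly_ind: q => [|q d IHq];
  first by rewrite rmorph0 lfunE mem0v.
rewrite rmorphD rmorphM /= horner_algC horner_algX add_lfunE lfun_mulE.
by rewrite scale_lfunE id_lfunE memvD ?memvZ ?DV.
Qed.

(** Peel off one factor X - c: either the remaining product q(D) already kills x, or q(D) x is an
    eigenvector for c. *)
Lemma exists_eigenvector (V : {vspace L}) (s : seq k) x :
    {in V, forall y, D y \in V} -> x \in V -> x != 0 ->
    horner_alg D (\prod_(c <- s) ('X - c%:P)) x = 0 ->
  exists c y, [/\ c \in s, y \in V, y != 0 & D y = c *: y].
Proof.
move=> DV xV nzx; elim: s => [|c s IHs].
  by rewrite big_nil rmorph1 => /eqP; rewrite id_lfunE (negPf nzx).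
rewrite big_cons mulrC; set q := \prod_(c <- s) _ in IHs *.
have [/IHs [d [y [ds yV nzy Dy]]] _|nzq] := eqVneq (horner_alg D q x) 0.
  by exists d, y; split=> //; rewrite inE ds orbT.
rewrite rmorphM rmorphB /= horner_algC horner_algX lfun_mulE add_lfunE.
rewrite opp_lfunE scale_lfunE id_lfunE => /eqP; rewrite subr_eq0 => /eqP Dy.
by exists c, (horner_alg D q x); rewrite mem_head horner_alg_stable.
Qed.

End HornerEigen.

Lemma pchar_natr_neq0 i : (0 < i < p)%N -> i%:R != 0 :> k.
Proof. by case/andP=> i0 ip; rewrite -(dvdn_pcharf hp) gtnNdvd. Qed.

Lemma pchar_natr_inj i j : (i < p)%N -> (j < p)%N -> i%:R = j%:R :> k -> i = j.
Proof.
wlog ij : i j / (i <= j)%N => [hw ip jp e|_ jp /esym/eqP].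
  by case: (leqP i j) => [/hw|/ltnW/hw h]; [apply|rewrite h].
rewrite -subr_eq0 -natrB // => e; apply/eqP; rewrite eqn_leq ij -subn_eq0.
apply: contraLR e => nz; apply: pchar_natr_neq0.
by rewrite lt0n nz (leq_ltn_trans (leq_subr _ _)).
Qed.

Lemma expr_pchar_natr i : i%:R ^+ p = i%:R :> k.
Proof. by rewrite -pFrobenius_autE pFrobenius_aut_nat. Qed.

(** By Fermat the p - 1 distinct nonzero elements of the prime field are roots, which exhausts the
    degree. *)
Lemma prod_Xsub_natr :
  'X^(p.-1) - 1 = \prod_(c <- [seq i%:R | i <- iota 1 p.-1]) ('X - c%:P) :>
    {poly k}.
Proof.
have p1 := prime_gt1 p_prime; have p2 : (0 < p.-1)%N by rewrite -ltnS prednK //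
  ltnW.
rewrite -polyC1; have lc : lead_coef ('X^(p.-1) - 1%:P : {poly k}) = 1.
  by apply/eqP; rewrite -monicE monicXnsubC.
rewrite [LHS](all_roots_prod_XsubC (rs := [seq i%:R | i <- iota 1 p.-1])).
- by rewrite lc scale1r.
- by rewrite size_XnsubC // size_map size_iota.
- apply/allP=> c /mapP[i]; rewrite mem_iota add1n (prednK (prime_gt0 p_prime))
    => ip ->.
  rewrite /root !hornerE subr_eq0; apply/eqP;
    apply: (mulfI (pchar_natr_neq0 ip)).
  by rewrite -exprS (prednK (prime_gt0 p_prime)) expr_pchar_natr mulr1.
- rewrite uniq_rootsE map_inj_in_uniq ?iota_uniq // => i j.
  rewrite !mem_iota add1n (prednK (prime_gt0 p_prime)) => /andP[_ ip] /andP[_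
    jp].
  exact: pchar_natr_inj.
Qed.

Lemma exists_unit_eigenvector (U : {vspace 'End(L)}) D Y :
    {in U, forall X, derivation X} -> {in U &, forall X Y, br X Y \in U} ->
    D \in U -> D != 0 -> pm D = D -> Y \in U -> Y \notin <[D]>%VS ->
  exists E u, [/\ E \in U, E != 0, dmul E u \in U, u != 0 & E u = u].
Proof.
move=> derU brU DU nzD pD YU YD; have hD := derU _ DU.
(* Under a |-> a D, the action of ad D on U becomes the action of D on V. *)
pose V := (linfun (dmul D) @^-1: U)%VS.
have memV a : (a \in V) = (dmul D a \in U) by rewrite -memv_preim lfunE.
have DV : {in V, forall a, D a \in V}.
  move=> a; rewrite !memV => aV; have := brU _ _ DU aV.
  rewrite -{1}(dmul1 D) br_dmul // -[in D 1](scale1r 1) derivation_scalar //.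
  by rewrite mulr0 subr0 mul1r.
have [b Yb] := derivation_dmul_of hD nzD (derU _ YU).
have nzDb : D b != 0.
  apply: contraNneq YD => Db; have [c bc] := derivation_ker hD nzD Db.
  by rewrite Yb bc dmul_alg memvZ ?memv_line.
have bV : D b \in V by rewrite DV // memV -Yb.
(* The vector is D b rather than b: as D^p = D, it is killed by D^(p-1) - 1, whose roots exclude the
   eigenvalue 0. *)
have [|c [y [cs yV nzy Dy]]] := exists_eigenvector (s := [seq i%:R | i <- iota
  1 p.-1]) DV bV nzDb.
  rewrite -prod_Xsub_natr rmorphB rmorph1 rmorphXn /= horner_algX.
  rewrite add_lfunE opp_lfunE id_lfunE.
  have iterD n x : (D ^+ n) x = iter n D x.
    by elim: n => [|n IHn]; rewrite ?expr0 ?id_lfunE // exprSr lfun_mulE IHn.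
  rewrite iterD -iterSr (prednK (prime_gt0 p_prime)).
  by move/lfunP/(_ b): pD; rewrite End_pmapE => ->; rewrite subrr.
have /mapP[i] := cs; rewrite mem_iota add1n (prednK (prime_gt0 p_prime)) => ip
  ci.
have nzc : c != 0 by rewrite ci pchar_natr_neq0.
(* Dividing D by c turns the eigenvalue of y into 1. *)
exists (c^-1 *: D), y; split=> //; first by rewrite memvZ.
- by rewrite scaler_eq0 invr_eq0 negb_or nzc.
- rewrite (_ : dmul _ _ = c^-1 *: dmul D y) ?memvZ -?memV //.
  by apply/lfunP=> x; rewrite dmulE !scale_lfunE dmulE scalerAr.
- by rewrite scale_lfunE Dy scalerA mulVf // scale1r.
Qed.

(** * Subspaces of L in the eigenbasis of powers of u *)

Section UnitEigenvector.

Variables (D : 'End(L)) (u : L).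
Hypotheses (hD : derivation D) (nzu : u != 0) (Du : D u = u).

Lemma derivation_expu j : D (u ^+ j) = j%:R *: u ^+ j.
Proof.
rewrite derivation_exp // Du; case: j => [|j];
  first by rewrite mulr0n mul0r scale0r.
by rewrite mulrnAl -exprSr scaler_nat.
Qed.

(** The powers of u have distinct eigenvalues j in the prime field; a polynomial q vanishing at all
    of them but one makes q(D) isolate a single term of the sum. *)
Lemma expu_mem (V : {vspace L}) (c : 'I_p -> k) :
    {in V, forall y, D y \in V} -> \sum_j c j *: u ^+ j \in V ->
  forall j, c j != 0 -> u ^+ j \in V.
Proof.
move=> DV xV j nzcj.
pose q := \prod_(i < p | i != j) ('X - (i%:R)%:P) : {poly k}.
have qj : q.[j%:R] != 0.
  rewrite horner_prod; apply/prodf_neq0=> i ij; rewrite !hornerE subr_eq0.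
  by apply: contra ij => /eqP/pchar_natr_inj/val_inj->.
have := horner_alg_stable q DV xV.
rewrite linear_sum (bigD1 j) //= big1 ?addr0 => [|i ij].
  rewrite linearZ /= (horner_alg_eigen _ (derivation_expu j)) scalerA.
  by rewrite rpredZeq mulf_eq0 (negPf nzcj) (negPf qj).
rewrite linearZ /= (horner_alg_eigen _ (derivation_expu i)).
rewrite horner_prod (bigD1 i) //= !hornerE subrr mul0r scale0r.
by rewrite scaler0.
Qed.

Definition expu : p.-tuple L := [tuple u ^+ i | i < p].

(** Freeness is [expu_mem] for V = 0: a nonzero coefficient would put a power of u in 0. *)
Lemma expu_basis : basis_of fullv expu.
Proof.
rewrite basisEfree subvf size_tuple /= dimL leqnn andbT.
apply/(@freeP _ _ _ expu)=> c c0 j; apply/eqP; apply/negPn/negP=> nzc.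
suff: u ^+ j \in 0%VS by rewrite memv0 expf_eq0 (negPf nzu) andbF.
refine (@expu_mem 0%VS c _ _ j nzc); first by move=> y;
  rewrite memv0 => /eqP->; rewrite linear0 mem0v.
rewrite (_ : \sum_i _ = 0) ?mem0v // -[RHS]c0; apply: eq_bigr => i _.
by rewrite -tnth_nth tnth_mktuple.
Qed.

Lemma expu_sum x : exists c : 'I_p -> k, x = \sum_j c j *: u ^+ j.
Proof.
exists (fun j => coord expu j x).
rewrite {1}(coord_basis expu_basis (memvf x)); apply: eq_bigr => i _.
by rewrite -tnth_nth tnth_mktuple.
Qed.

Lemma expu_full (V : {vspace L}) :
  (forall j, (j < p)%N -> u ^+ j \in V) -> V = fullv.
Proof.
move=> uV; apply/vspaceP=> x; rewrite memvf; have [c ->] := expu_sum x.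
by apply: memv_suml => j _; rewrite memvZ ?uV.
Qed.

(* The exponents j < p with u ^+ j in V are closed under addition modulo p of
   distinct elements; as they contain 0 and 1 but not everything, no other
   exponent than p - 1 can occur. *)
Lemma subspace_unit_eigenvector (V : {vspace L}) :
    {in V &, forall a b, a * D b - b * D a \in V} ->
    1 \in V -> u \in V -> V != fullv ->
  (forall x, x \in V -> exists c d, x = c%:A + d *: u) \/
  [/\ p != 2%N, u^-1 \in V &
      forall x, x \in V -> exists c d e, x = c%:A + d *: u + e *: u^-1].
Proof.
move=> brV V1 Vu Vnf.
have DV : {in V, forall y, D y \in V}.
  move=> y yV; have := brV _ _ V1 yV.
  by rewrite -[in D 1](scale1r 1) derivation_scalar // mulr0 subr0 mul1r.
have p1 := prime_gt1 p_prime; have pK := prednK (prime_gt0 p_prime).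
(* D(u^p) = p u^p = 0, so u^p is a nonzero constant and exponents matter only modulo p. *)
have [c nzc upc] : exists2 c, c != 0 & u ^+ p = c%:A.
  have nzD : D != 0 by apply: contraNneq nzu => D0; rewrite -Du D0 lfunE.
  have Dup : D (u ^+ p) = 0 by rewrite derivation_expu (pcharf0 hp) scale0r.
  have [c uc] := derivation_ker hD nzD Dup.
  exists c => //; apply: contraNneq nzu => c0; move/eqP: uc.
  by rewrite c0 scale0r expf_eq0 => /andP[].
have uVp1 : u^-1 = c^-1 *: u ^+ p.-1.
  apply: (mulfI nzu); rewrite divff // -scalerAr -exprS pK upc.
  by rewrite scalerA mulVf ?scale1r.
have addV i j : (i < p)%N -> (j < p)%N -> i != j ->
    u ^+ i \in V -> u ^+ j \in V -> u ^+ (i + j) \in V.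
  move=> ip jp ij iV jV; have := brV _ _ iV jV; rewrite !derivation_expu.
  rewrite -!scalerAr -!exprD [(j + i)%N]addnC -scalerBl rpredZeq subr_eq0.
  by case: eqP => // /(pchar_natr_inj jp ip) ji; rewrite ji eqxx in ij.
have up j : (1 < j)%N -> u ^+ j \in V -> forall n, (j + n < p)%N -> u ^+ (j +
  n) \in V.
  move=> j1 jV; elim=> [|n IHn] jn; first by rewrite addn0.
  have jn' : (j + n < p)%N by apply: leq_ltn_trans jn; rewrite leq_add2l.
  rewrite addnS -addn1; apply: addV => //; last exact: IHn.
  by rewrite gtn_eqF // ltn_addr.
(* From such a j, adding 1 climbs to p - 1; adding p - 1 then lowers the exponent by 1 modulo p,
   from j down to 0. So V would be everything. *)
have small j : (1 < j)%N -> (j < p.-1)%N -> u ^+ j \notin V.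
  move=> j1 jp; apply/negP=> jV; case/eqP: Vnf.
  have jp' : (j < p)%N by rewrite -pK ltnW.
  have topV : u ^+ p.-1 \in V.
    by rewrite -(subnKC (ltnW jp)); apply: up => //; rewrite subnKC ?pK // ltnW.
  have down n : (n <= j)%N -> u ^+ (j - n) \in V.
    elim: n => [|n IHn] nj; first by rewrite subn0.
    have : u ^+ (p.-1 + (j - n)) \in V.
      apply: addV; rewrite ?IHn ?(ltnW nj) //.
      - by rewrite ltn_predL prime_gt0.
      - by apply: leq_ltn_trans jp'; apply: leq_subr.
      - by rewrite gtn_eqF //; apply: leq_ltn_trans jp; apply: leq_subr.
    rewrite -(subnSK nj) addnS -addSn pK exprD upc -scalerAl mul1r rpredZeq.
    by rewrite (negPf nzc).
  apply: expu_full => i ip; have [ij|ji] := leqP i j.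
    by rewrite -(subKn ij) down ?leq_subr.
  by rewrite -(subnKC (ltnW ji)) up // subnKC // ltnW.
have sumV x : x \in V -> exists2 a : 'I_p -> k, x = \sum_j a j *: u ^+ j &
    forall j : 'I_p, u ^+ j \notin V -> a j = 0.
  move=> xV; have [a xa] := expu_sum x; exists a => // j jV.
  by apply: contraNeq jV; apply: expu_mem DV _ _; rewrite -xa.
pose o0 : 'I_p := Ordinal (ltnW p1); pose o1 : 'I_p := Ordinal p1.
(* The bound 2 < p keeps the exponents 0, 1 and p - 1 distinct; for p = 2 the last is 1. *)
have [topV|topV] := boolP ((2 < p)%N && (u ^+ p.-1 \in V)); [right|left].
  case/andP: topV => p2 topV; split; first by rewrite gtn_eqF.
    by rewrite uVp1 memvZ.
  have lp : (p.-1 < p)%N by rewrite pK.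
  pose ot : 'I_p := Ordinal lp.
  have t1 : ot != o1 by rewrite -val_eqE /= gtn_eqF // -ltnS pK.
  have t0 : ot != o0 by rewrite -val_eqE /= gtn_eqF // -ltnS pK.
  (* The factor c comes from u^(p-1) = c u^-1. *)
  move=> x /sumV[a -> a0]; exists (a o0), (a o1), (a ot * c).
  rewrite (bigD1 o0) // (bigD1 o1) // (bigD1 ot) ?t0 ?t1 // big1 ?addr0 /=.
    by rewrite addr0 expr0 expr1 addrA uVp1 scalerA mulfK.
  move=> j; rewrite -!val_eqE /= => /andP[/andP[j0 j1] jt].
  rewrite a0 ?scale0r //; apply: small.
    by rewrite ltn_neqAle eq_sym j1 lt0n j0.
  by rewrite ltn_neqAle jt -ltnS pK ltn_ord.
move=> x /sumV[a -> a0]; exists (a o0), (a o1).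
rewrite (bigD1 o0) // (bigD1 o1) //= big1 ?addr0 ?expr1 //.
move=> j; rewrite -!val_eqE /= => /andP[j0 j1].
have j2 : (1 < j)%N by rewrite ltn_neqAle eq_sym j1 lt0n j0.
rewrite a0 ?scale0r //; have [jt|jt] := eqVneq (j : nat) p.-1; last first.
  by apply: small; rewrite // ltn_neqAle jt -ltnS pK ltn_ord.
by move: topV; rewrite -jt (leq_ltn_trans j2).
Qed.

End UnitEigenvector.

(** * Identification with the four models *)

Section Subalgebra.

Variables (g : {vspace Der_lie hp L}) (hg : restricted_subalgebra g).

Definition sub_val (x : sub_lie hg) : 'End(L) := vsval (vsval x).

Fact sub_val_is_linear : linear sub_val.
Proof. by move=> c x y; rewrite /sub_val !linearP. Qed.

HB.instance Definition _ :=
  GRing.isLinear.Build k (sub_lie hg) 'End(L) _ sub_val sub_val_is_linear.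

(** The model is realized in L under the bracket a D(b) - b D(a), which a |-> a D carries to the
    commutator. Compatibility with p-maps is either given or forced by a trivial center. *)
Lemma sub_lie_isomorphic (H : restrictedLieType k p) D (phi : {linear H -> L}) :
    derivation D -> D != 0 -> injective phi ->
    (forall x : sub_lie hg, exists y : H, sub_val x = dmul D (phi y)) ->
    (forall y : H, exists x : sub_lie hg, dmul D (phi y) = sub_val x) ->
    (forall x y : H, phi (bracket x y) = phi x * D (phi y) - phi y * D (phi x))
        ->
    (forall y : H, dmul D (phi (pmap y)) = pm (dmul D (phi y))) \/
      (forall z : H, (forall x : H, bracket z x = 0) -> z = 0) ->
  rl_isomorphic (sub_lie hg) H.
Proof.
move=> hD nzD phi_inj vF Fv phi_br phi_pm.
pose W := End_lie hp L.
pose i : {linear sub_lie hg -> W} := sub_val.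
pose F : {linear H -> W} := dmul D \o phi.
have F_inj : injective F by move=> x y /(dmul_inj nzD)/phi_inj.
have F_br : {morph F : x y / bracket x y}.
  by move=> x y; rewrite /F /= phi_br -br_dmul.
have i_pm : {morph i : x / pmap x} by [].
apply: (rl_isomorphic_of_images (i := i) (F := F)) => //.
  by move=> x y /val_inj/val_inj.
by case: phi_pm => [//|]; apply: (pmap_morph_centerless F_inj vF Fv F_br i_pm).
Qed.

(** The center is trivial: commuting with a nonzero constant gives D(phi z) = 0, and then commuting
    with u gives phi(z) u = 0. *)
Lemma sub_lie_isomorphic_centerless (H : restrictedLieType k p) D u
    (phi : {linear H -> L}) :
    derivation D -> D u = u -> u != 0 -> injective phi ->
    (forall x : sub_lie hg, exists y : H, sub_val x = dmul D (phi y)) ->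
    (forall y : H, exists x : sub_lie hg, dmul D (phi y) = sub_val x) ->
    (forall x y : H, phi (bracket x y) = phi x * D (phi y) - phi y * D (phi x))
        ->
    (exists2 x : H, exists c, phi x = c%:A & phi x != 0) ->
    (exists x : H, phi x = u) ->
  rl_isomorphic (sub_lie hg) H.
Proof.
move=> hD Du nzu phi_inj vF Fv phi_br [x0 [c x0c] nzx0] [xu xuE].
have nzD : D != 0 by apply: contraNneq nzu => D0; rewrite -Du D0 lfunE.
apply: (sub_lie_isomorphic hD nzD phi_inj vF Fv phi_br); right=> z zC.
have D0 : D (phi z) = 0.
  have := phi_br z x0; rewrite zC linear0 x0c derivation_scalar // mulr0 sub0r.
  move/esym/eqP; rewrite oppr_eq0 -x0c mulf_eq0 (negPf nzx0) /=.
  by move/eqP.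
have := phi_br z xu; rewrite zC linear0 xuE D0 Du mulr0 subr0 => /esym/eqP.
rewrite mulf_eq0 (negPf nzu) orbF -(linear0 phi) => /eqP/phi_inj.
by [].
Qed.

Definition scalar_map (c : k^o) : L := c%:A.

Fact scalar_map_is_linear : linear scalar_map.
Proof. by move=> c a b; rewrite /scalar_map scalerDl scalerA. Qed.

HB.instance Definition _ :=
  GRing.isLinear.Build k k^o L _ scalar_map scalar_map_is_linear.

Lemma scalar_map_inj : injective scalar_map.
Proof. exact: (fmorph_inj (in_alg L)). Qed.

Section Line.

Variable D : 'End(L).
Hypotheses (hD : derivation D) (nzD : D != 0).
Hypothesis D_span : forall x, exists c, sub_val x = c *: D.
Hypothesis D_mem : forall c, exists x, c *: D = sub_val x.

Let in_line (x : sub_lie hg) : exists c : k^o, sub_val x = dmul D (scalar_map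
  c).
Proof. by have [c ->] := D_span x; exists c; rewrite dmul_alg. Qed.

Let line_in (c : k^o) : exists x, dmul D (scalar_map c) = sub_val x.
Proof. by have [x cx] := D_mem c; exists x; rewrite dmul_alg. Qed.

Let line_br (a b : k^o) :
  0 = scalar_map a * D (scalar_map b) - scalar_map b * D (scalar_map a).
Proof. by rewrite !derivation_scalar // !mulr0 subr0. Qed.

Lemma line_isomorphic_k : pm D = 0 -> rl_isomorphic (sub_lie hg) (k_lie hp).
Proof.
move=> pD; apply: (sub_lie_isomorphic (H := k_lie hp) hD nzD scalar_map_inj) =>
  //.
  by move=> a b; rewrite -line_br linear0.
by left=> c; rewrite linear0 linear0 dmul_alg [RHS](pmapZ ax) -/pm pD scaler0.
Qed.

Lemma line_isomorphic_gl1 : pm D = D -> rl_isomorphic (sub_lie hg) (gl1_lie hp).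
Proof.
move=> pD; apply: (sub_lie_isomorphic (H := gl1_lie hp) hD nzD scalar_map_inj)
  => //.
  by move=> a b; rewrite -line_br linear0.
by left=> c; rewrite !dmul_alg [RHS](pmapZ ax) -/pm pD.
Qed.

End Line.

Section NonAbelian.

Variables (D : 'End(L)) (u : L).
Hypotheses (hD : derivation D) (nzu : u != 0) (Du : D u = u).

(** Here e goes to 1 and v to v u, because [D, u D] = u D. *)
Definition semi_map (x : k^o * k^o) : L := x.2%:A + x.1 *: u.

Fact semi_map_is_linear : linear semi_map.
Proof.
move=> c x y; rewrite /semi_map /= !scalerDl scalerDr !scalerA addrACA.
by [].
Qed.

HB.instance Definition _ :=
  GRing.isLinear.Build k (k^o * k^o)%type L _ semi_map semi_map_is_linear.

Lemma D_semi_map x : D (semi_map x) = x.1 *: u.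
Proof. by rewrite /semi_map linearD /= derivation_scalar // add0r linearZ /=
  Du. Qed.

Lemma semi_map_inj : injective semi_map.
Proof.
apply: raddf_inj => x x0; have := D_semi_map x; rewrite x0 linear0.
move/esym/eqP; rewrite scaler_eq0 (negPf nzu) orbF => /eqP x10.
move/eqP: x0; rewrite /= /semi_map x10 scale0r addr0 scaler_eq0 oner_eq0 orbF.
by move/eqP=> x20; case: x x10 x20 => a b /= -> ->.
Qed.

Lemma isomorphic_semi :
    (forall x, exists c d, sub_val x = dmul D (c%:A + d *: u)) ->
    (forall c d, exists x, dmul D (c%:A + d *: u) = sub_val x) ->
  rl_isomorphic (sub_lie hg) (semi_lie hp).
Proof.
move=> vF Fv; apply: (sub_lie_isomorphic_centerless (H := semi_lie hp) hD Du
  nzu semi_map_inj).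
- by move=> x; have [c [d ->]] := vF x; exists (d, c).
- by move=> y; apply: Fv.
- case=> [a b] [c d]; rewrite /= !D_semi_map /semi_map /= scale0r add0r.
  rewrite !mulrDl -!scalerAl -!scalerAr !scalerA !mul1r opprD addrACA.
  by rewrite [a * c]mulrC subrr addr0 -scalerBl.
- exists (0, 1); first by exists 1; rewrite /= /semi_map /= scale0r addr0.
  by rewrite /= /semi_map /= scale0r addr0 scale1r oner_eq0.
- by exists (1, 0); rewrite /= /semi_map /= scale0r add0r scale1r.
Qed.

(** The standard triple h, e, f goes to 2, u, -u^-1; the sign makes [e, f] = h, since D(u^-1) =
    -u^-1. *)
Definition sl2_map (M : sl2_lie hp) : L :=
  let m : 'M[k]_2 := vsval M in
  (2 * m 0 0)%:A + (m 0 1)%:A * u - (m 1 0)%:A / u.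

Fact sl2_map_is_linear : linear sl2_map.
Proof.
move=> c M N; rewrite /sl2_map linearP /= !mxE -(mulr_algl c) -!in_algE.
rewrite !(rmorphM, rmorphD, rmorph_nat) /=; ring.
Qed.

HB.instance Definition _ :=
  GRing.isLinear.Build k (sl2_lie hp) L _ sl2_map sl2_map_is_linear.

Lemma derivation_inv : D u^-1 = - u^-1.
Proof.
have := hD u u^-1; rewrite divff // -[in D 1](scale1r 1) derivation_scalar //.
rewrite Du divff // => /esym/eqP; rewrite addrC addr_eq0 => /eqP uD.
by apply: (mulfI nzu); rewrite uD mulrN divff.
Qed.

Lemma D_sl2_map (M : sl2_lie hp) (m : 'M[k]_2 := vsval M) :
  D (sl2_map M) = (m 0 1)%:A * u + (m 1 0)%:A / u.
Proof.
rewrite /sl2_map linearB linearD /= derivation_scalar // add0r !mulr_algl.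
by rewrite !linearZ /= Du derivation_inv opprK.
Qed.

Hypothesis p_neq2 : p != 2%N.

Let two_neq0 : 2 != 0 :> k.
Proof. by apply: pchar_natr_neq0;
  rewrite /= ltn_neqAle eq_sym p_neq2 prime_gt1. Qed.

Lemma sl2_map_inj : injective sl2_map.
Proof.
apply: raddf_inj => M M0; pose m : 'M[k]_2 := vsval M.
have /= := D_sl2_map M; rewrite M0 linear0 -/m !mulr_algl => /esym e1.
(* A second application of D flips the sign of the u^-1 term, which separates the two coefficients
   as 2 != 0. *)
have := congr1 D e1; rewrite linearD !linearZ linear0 /= Du derivation_inv
  scalerN.
move=> e2.
have m01 : m 0 1 = 0.
  have /eqP : (2 * m 0 1) *: u = 0.
    by rewrite -[RHS](addr0 0) -{1}e1 -e2 mulr_natl mulr2n scalerDl addrACA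
      subrr addr0.
  by rewrite scaler_eq0 (negPf nzu) orbF mulf_eq0 (negPf two_neq0) => /eqP.
have m10 : m 1 0 = 0.
  move/eqP: e1; rewrite m01 scale0r add0r scaler_eq0 invr_eq0 (negPf nzu) orbF.
  by move/eqP.
have m00 : m 0 0 = 0.
  move/eqP: M0; rewrite /= /sl2_map -/m m01 m10 !scale0r !mul0r subr0 addr0.
  by rewrite scaler_eq0 oner_eq0 orbF mulf_eq0 (negPf two_neq0) => /eqP.
by apply: sl2_ext; rewrite /= mxE.
Qed.

Lemma isomorphic_sl2 :
    (forall x, exists c d e, sub_val x = dmul D (c%:A + d *: u + e *: u^-1)) ->
    (forall c d e, exists x, dmul D (c%:A + d *: u + e *: u^-1) = sub_val x) ->
  rl_isomorphic (sub_lie hg) (sl2_lie hp).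
Proof.
move=> vF Fv; apply: (sub_lie_isomorphic_centerless (H := sl2_lie hp) hD Du nzu
  sl2_map_inj).
- move=> x; have [c [d [e ->]]] := vF x.
  have [M [m00 m01 m10]] := sl2_exists hp (c / 2) d (- e).
  exists M; congr (dmul D _); rewrite /= /sl2_map m00 m01 m10 mulrC divfK //.
  by rewrite !mulr_algl scaleNr opprK.
- move=> M; have [x xE] := Fv (2 * (vsval M : 'M[k]_2) 0 0)
    ((vsval M : 'M[k]_2) 0 1) (- (vsval M : 'M[k]_2) 1 0).
  by exists x; rewrite -xE /= /sl2_map !mulr_algl scaleNr.
- move=> M N; rewrite /= !D_sl2_map /sl2_map.
  have [-> -> ->] := sl2_bracketE M N.
  rewrite -!in_algE !(rmorphM, rmorphB, rmorph_nat) /=.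
  by field.
- have [M [m00 m01 m10]] := sl2_exists hp 1 0 0; exists M; last first.
    rewrite /= /sl2_map m00 m01 m10 !scale0r !mul0r subr0 addr0 mulr1.
    by rewrite scaler_eq0 oner_eq0 orbF.
  by exists 2; rewrite /= /sl2_map m00 m01 m10 !scale0r !mul0r subr0 addr0
    mulr1.
- have [M [m00 m01 m10]] := sl2_exists hp 0 1 0; exists M.
  by rewrite /= /sl2_map m00 m01 m10 mulr0 !scale0r mul0r subr0 add0r scale1r
    mul1r.
Qed.

End NonAbelian.

(** * The classification by dimension *)

Let U : {vspace 'End(L)} :=
  (linfun (vsval : Der_lie hp L -> 'End(L)) @: g)%VS.

Let memU X : reflect (exists x, X = sub_val x) (X \in U).
Proof.
apply: (iffP memv_imgP) => [[y yg ->]|[x ->]].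
  by exists (Subvs yg); rewrite lfunE.
by exists (vsval x); rewrite ?subvsP ?lfunE.
Qed.

Let dimU : \dim U = \dim g.
Proof.
apply: limg_dim_eq; apply/eqP; rewrite -subv0; apply/subvP=> x.
rewrite memv_cap memv_ker lfunE memv0 => /andP[_ /eqP x0].
by apply/eqP/val_inj.
Qed.

Let derU : {in U, forall X, derivation X}.
Proof. move=> _ /memU[x ->]; apply/(memv_Der hp);
  exact: (subvsP (vsval x)). Qed.

Let brU : {in U &, forall X Y, br X Y \in U}.
Proof.
move=> _ _ /memU[x ->] /memU[y ->]; apply/memU.
by exists (bracket x y).
Qed.

Lemma sub_lie_classification : (1 <= \dim g <= p - 1)%N ->
  [\/ rl_isomorphic (sub_lie hg) (k_lie hp),
      rl_isomorphic (sub_lie hg) (gl1_lie hp),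
      rl_isomorphic (sub_lie hg) (semi_lie hp)
    | rl_isomorphic (sub_lie hg) (sl2_lie hp)].
Proof.
rewrite -dimU => /andP[dimU1 dimUp].
pose D := vpick U.
have nzD : D != 0 by rewrite vpick0 -dimv_eq0 -lt0n.
have DU : D \in U by apply: memv_pick.
have [U1|U2] := leqP (\dim U) 1.
  have Uline : U = <[D]>%VS.
    by apply/esym/eqP; rewrite eqEdim -memvE DU dim_vline nzD.
  have span E : <[E]>%VS = U -> forall x : sub_lie hg, exists c, sub_val x = c
    *: E.
    by move=> UE x; apply/vlineP; rewrite UE; apply/memU; exists x.
  have mem E : <[E]>%VS = U -> forall c, exists x : sub_lie hg, c *: E =
    sub_val x.
    by move=> UE c; apply/memU; rewrite -UE memvZ ?memv_line.
  have [pD|nzpD] := eqVneq (pm D) 0.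
    constructor 1; apply: (line_isomorphic_k (D := D)) => //; first exact: derU.
    - exact: span.
    - exact: mem.
  have [c nzc pcD] := pmap_normalize (derU DU) nzpD.
  have cDU : <[c *: D]>%VS = U.
    apply/eqP; rewrite eqEdim -memvE memvZ // dim_vline scaler_eq0 negb_or nzc
      nzD.
    exact: U1.
  constructor 2; apply: (line_isomorphic_gl1 (D := c *: D)) => //.
  - by apply/derU/memvZ.
  - by rewrite scaler_eq0 negb_or nzc.
  - exact: span.
  - exact: mem.
have out E : exists2 Y, Y \in U & Y \notin <[E]>%VS.
  apply/subvPn; apply: contraL U2 => /dimvS; rewrite dim_vline -leqNgt => UE.
  exact: leq_trans UE (leq_b1 _).
have [Y YU YD] := out D.
have [X XU pX] := pmap_neq0 derU brU DU nzD YU YD.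
have [c nzc pcX] := pmap_normalize (derU XU) pX.
have cXU : c *: X \in U by apply: memvZ.
have nzcX : c *: X != 0.
  rewrite scaler_eq0 negb_or nzc; apply: contraNneq pX => ->.
  (* The p-map vanishes at 0, by homogeneity with scalar 0. *)
  by rewrite -(scale0r 0) [pm _](pmapZ ax) expr0n gtn_eqF ?prime_gt0 ?scale0r.
(* Y avoids only the line of D; the line to leave is now that of c X. *)
have [Z ZU ZX] := out (c *: X).
have [E [u [EU nzE uEU nzu Eu]]] := exists_unit_eigenvector derU brU cXU nzcX
  pcX ZU ZX.
have hE := derU EU.
pose V := (linfun (dmul E) @^-1: U)%VS.
have memV a : (a \in V) = (dmul E a \in U) by rewrite -memv_preim lfunE.
have brV : {in V &, forall a b, a * E b - b * E a \in V}.
  by move=> a b; rewrite !memV => aV bV; rewrite -br_dmul // brU.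
have V1 : 1 \in V by rewrite memV dmul1.
have Vu : u \in V by rewrite memV.
(* This uses the upper bound on the dimension: a |-> a E is injective, so V = L would give dim U >=
   p. *)
have Vnf : V != fullv.
  apply: contraTneq dimUp => Vf; rewrite -ltnNge subn1 prednK ?prime_gt0 //.
  rewrite -dimL -(limg_dim_eq (f := linfun (dmul E))); last first.
    apply/eqP; rewrite -subv0; apply/subvP=> a;
      rewrite memv_cap memv_ker lfunE /=.
    by rewrite memv0 -{1}(linear0 (dmul E)) => /andP[_ /eqP/(dmul_inj nzE)->].
  by apply/dimvS/subvP=> _ /memv_imgP[a _ ->]; rewrite lfunE /= -memV Vf memvf.
have inV x : exists2 a, a \in V & sub_val x = dmul E a.
  have xU : sub_val x \in U by apply/memU; exists x.
  have [a xa] := derivation_dmul_of hE nzE (derU xU).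
  by exists a; rewrite // memV -xa.
have [V2|[p2 Vu1 V3]] := subspace_unit_eigenvector hE nzu Eu brV V1 Vu Vnf.
  constructor 3; apply: (isomorphic_semi hE nzu Eu) => [x|c' d].
    by have [a /V2[c' [d ->]] ->] := inV x; exists c', d.
  by apply/memU; rewrite -memV memvD ?memvZ.
constructor 4; apply: (isomorphic_sl2 hE nzu Eu p2) => [x|c' d e].
  by have [a /V3[c' [d [e ->]]] ->] := inV x; exists c', d, e.
by apply/memU; rewrite -memV !memvD ?memvZ.
Qed.

End Subalgebra.

End PrimeDegree.

(** * Application to k[t]/(t^p - omega) *)

Theorem theorem9p5 (k : fieldType) (p : nat) (hp : p \in [pchar k]) (omega : k)
    (homega : forall x : k, x ^+ p <> omega)
    (hroots : forall x : k, x != 0 -> exists2 y : k, y != 0 & y ^+ p.-1 = x)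
    (hBr : forall A : falgType k, ~ brauer_order_two A)
    (g' : {vspace Der_lie hp {poly %/ 'X^p - omega%:P}})
    (hg' : restricted_subalgebra g')
    (hdim : (1 <= \dim g' <= p - 1)%N) :
  [\/ rl_isomorphic (sub_lie hg') (k_lie hp),
      rl_isomorphic (sub_lie hg') (gl1_lie hp),
      rl_isomorphic (sub_lie hg') (semi_lie hp)
    | rl_isomorphic (sub_lie hg') (sl2_lie hp)].
Proof.
have pp := pcharf_prime hp; have p0 := prime_gt0 pp.
have hI : monic_irreducible_poly ('X^p - omega%:P).
  by split; [apply: irreducible_XnsubC | apply: monicXnsubC].
have dimL : \dim {: {poly %/ 'X^p - omega%:P with hI}} = p.
  by rewrite (dim_polyn _ _) mk_monic_XpsubC // size_XnsubC.
(* With [hI] the quotient ring carries its field extension structure, and its derivation algebra is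
   the given one. *)
exact: (sub_lie_classification (L := {poly %/ 'X^p - omega%:P with hI}) dimL).
Qed.
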